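(* Let $A$ be a unital complex Banach algebra with unit $1 \neq 0$, let $n \geq 1$ be an integer, and let $a_0, a_1, \ldots, a_{n-1} \in A$. For $z \in \mathbb{C}$ put $p(z) = z^n 1 + z^{n-1} a_{n-1} + \cdots + z a_1 + a_0 \in A$. Then there exists $z \in \mathbb{C}$ such that $p(z)$ is not an invertible element of $A$.
   Context: The algebra $A$ is not assumed to be commutative. A monic polynomial with coefficients in $A$ is evaluated at complex scalars $z$, with powers of $z$ acting on the coefficients by scalar multiplication. Invertible means having a two-sided multiplicative inverse in $A$. *)

(* Defs.v *)
From HB Require Import structures.
From mathcomp Require Import all_boot all_order all_algebra.
From mathcomp Require Import complex.
From mathcomp Require Import all_classical all_reals all_analysis.

Set Implicit Arguments.
Unset Strict Implicit.
Unset Printing Implicit Defensive.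

Import Order.TTheory GRing.Theory Num.Theory.
Import numFieldNormedType.Exports.

Local Open Scope ring_scope.

(* HB rejects the join of [completeNormedModType K] and [algType K] (a common
   generalisation of it and of [numDomainType] would be needed), so the product
   is added here to a Banach space, and the [algType K] structure is derived
   below: the product is then the usual [x * y], with unit [1].
   The normalisation `|1| = 1 is not required. *)
HB.mixin Record CompleteNormedModule_isBanachAlgebra (K : numFieldType) A
    & CompleteNormedModule K A := {
  bone : A ;
  bmul : A -> A -> A ;
  bmulA : associative bmul ;
  bmul1x : left_id bone bmul ;
  bmulx1 : right_id bone bmul ;
  bmulDl : left_distributive bmul +%R ;
  bmulDr : right_distributive bmul +%R ;
  bone_neq0 : bone != 0 ;
  bscaleAl : forall (k : K) (x y : A), k *: bmul x y = bmul (k *: x) y ;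
  bscaleAr : forall (k : K) (x y : A), k *: bmul x y = bmul x (k *: y) ;
  ler_norm_bmul : forall x y : A, `|bmul x y| <= `|x| * `|y|
}.

#[short(type="banachAlgType")]
HB.structure Definition BanachAlgebra (K : numFieldType) :=
  {A of CompleteNormedModule K A & CompleteNormedModule_isBanachAlgebra K A}.

#[non_forgetful_inheritance]
HB.instance Definition _ (K : numFieldType) (A : banachAlgType K) :=
  GRing.Zmodule_isNzRing.Build (BanachAlgebra.sort A)
    (@bmulA K A) (@bmul1x K A) (@bmulx1 K A) (@bmulDl K A) (@bmulDr K A)
    bone_neq0.

#[non_forgetful_inheritance]
HB.instance Definition _ (K : numFieldType) (A : banachAlgType K) :=
  GRing.Lmodule_isLalgebra.Build K (BanachAlgebra.sort A) (@bscaleAl K A).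

#[non_forgetful_inheritance]
HB.instance Definition _ (K : numFieldType) (A : banachAlgType K) :=
  GRing.Lalgebra_isAlgebra.Build K (BanachAlgebra.sort A) (@bscaleAr K A).

Lemma ler_normM (K : numFieldType) (A : banachAlgType K) (x y : A) :
  `|x * y| <= `|x| * `|y|.
Proof. exact: ler_norm_bmul. Qed.

(* Unlike [x \is a GRing.unit], this needs no [unitRingType] structure. *)
Definition invertible (A : nzRingType) (x : A) : Prop :=
  exists y : A, x * y = 1 /\ y * x = 1.

(* Main.v *)
Require Import Defs.
From HB Require Import structures.
From mathcomp Require Import all_boot all_order all_algebra.
From mathcomp Require Import complex.
From mathcomp Require Import all_classical all_reals all_analysis.
From mathcomp Require Import lra.

Set Implicit Arguments.
Unset Strict Implicit.
Unset Printing Implicit Defensive.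

Import Order.TTheory GRing.Theory Num.Theory.
Import numFieldNormedType.Exports.

Local Open Scope ring_scope.
Local Open Scope complex_scope.
Local Open Scope classical_set_scope.

(** If every [p z] is invertible, the inverse [g z] is analytic and tends to [0]
    at infinity, so a Liouville argument forces [g 0 = 0], which is absurd.
    Liouville's theorem is obtained without functionals or contour integrals:
    all it uses is that [g] has, at each point, a Taylor expansion of order two
    with a remainder [O(h^3)]. Such expansions are stable under sums, products
    and two-sided inverses, and averaging them over [z + i^k h], [k < 4], leaves
    [g z + O(h^3)]. Hence [|g z| + e |z|^2], whose second term gains [e h^2] in
    the average, has no local maximum, whereas the decay of [g] would provide
    one if [g 0] were nonzero. *)

(** The norm of a complex space takes its values in [R[i]], where the order is partial. Its real
    part carries the same information and lives in a totally ordered field, where [lra] and [nra]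
    apply. *)
Definition rnorm (R : realType) (V : normedZmodType R[i]) (x : V) : R :=
  complex.Re `|x|.

(** * The norm as a real number *)

Section RealNorm.
Variable R : realType.

Lemma rnormE (V : normedZmodType R[i]) (x : V) : (rnorm x)%:C = `|x|.
Proof. by apply: RRe_real; apply: normr_real. Qed.

Lemma rnorm_ge0 (V : normedZmodType R[i]) (x : V) : 0 <= rnorm x.
Proof. by rewrite -lecR rnormE normr_ge0. Qed.

Lemma rnorm0 (V : normedZmodType R[i]) : rnorm (0 : V) = 0.
Proof. by rewrite /rnorm normr0. Qed.

Lemma rnorm_eq0 (V : normedZmodType R[i]) (x : V) : rnorm x = 0 -> x = 0.
Proof. by move=> x0; apply/eqP; rewrite -normr_eq0 -rnormE x0. Qed.

Lemma rnormN (V : normedZmodType R[i]) (x : V) : rnorm (- x) = rnorm x.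
Proof. by rewrite /rnorm normrN. Qed.

Lemma ler_rnormD (V : normedZmodType R[i]) (x y : V) :
  rnorm (x + y) <= rnorm x + rnorm y.
Proof. by rewrite -lecR rmorphD /= !rnormE ler_normD. Qed.

Lemma rnormZ (V : normedModType R[i]) (k : R[i]) (x : V) :
  rnorm (k *: x) = rnorm k * rnorm x.
Proof. by apply: complexI; rewrite rmorphM /= !rnormE normrZ. Qed.

Lemma ler_rnormM (A : banachAlgType R[i]) (x y : A) :
  rnorm (x * y) <= rnorm x * rnorm y.
Proof. by rewrite -lecR rmorphM /= !rnormE ler_normM. Qed.

Lemma rnormM (x y : R[i]) : rnorm (x * y) = rnorm x * rnorm y.
Proof. by apply: complexI; rewrite rmorphM /= !rnormE normrM. Qed.

Lemma rnormX (x : R[i]) j : rnorm (x ^+ j) = rnorm x ^+ j.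
Proof. by apply: complexI; rewrite rmorphXn /= !rnormE normrX. Qed.

Lemma ler_rnorm_sum (V : normedZmodType R[i]) n (F : 'I_n -> V) :
  rnorm (\sum_i F i) <= \sum_i rnorm (F i).
Proof.
elim/big_ind2 : _ => [|x1 x2 y1 y2 H1 H2|//]; first by rewrite rnorm0.
by rewrite (le_trans (ler_rnormD _ _)) // lerD.
Qed.

Lemma rnorm_real (x : R) : rnorm x%:C = `|x|.
Proof.
by apply: complexI; rewrite rnormE normc_def /= expr0n addr0 sqrtr_sqr.
Qed.

Lemma rnorm_i : rnorm ('i : R[i]) = 1.
Proof. by rewrite /rnorm normc_def /= expr0n expr1n add0r sqrtr1. Qed.

Lemma near0_rnorm_lt (e : R) : 0 < e ->
  \forall h \near (0 : R[i]^o), rnorm h < e.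
Proof.
move=> e0; apply/nbhs_ballP; exists e%:C => /=; first by rewrite ltcR.
by move=> h; rewrite /ball /= sub0r normrN -rnormE ltcR.
Qed.

Lemma near0_rnormP (P : R[i] -> Prop) : (\forall h \near (0 : R[i]^o), P h) ->
  exists2 d : R, 0 < d & forall h, rnorm h < d -> P h.
Proof.
move/nbhs_ballP => [e /= e0 He].
have eE : (complex.Re e)%:C = e by apply: RRe_real; apply: gtr0_real.
exists (complex.Re e); first by rewrite -ltcR eE.
by move=> h hd; apply: He; rewrite /ball /= sub0r normrN -rnormE -eE ltcR.
Qed.

End RealNorm.

(** * Functions that are O(1) at the origin *)

Section LocallyBounded.
Variable R : realType.
Implicit Type V : normedModType R[i].

Definition locbdd0 V (f : R[i] -> V) : Prop :=
  exists C : R, \forall h \near (0:R[i]^o), rnorm (f h) <= C.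

Lemma locbdd0_cst V (x : V) : locbdd0 (fun=> x).
Proof. by exists (rnorm x); near=> h. Unshelve. all: by end_near.
Qed.

Lemma locbdd0D V (f g : R[i] -> V) :
  locbdd0 f -> locbdd0 g -> locbdd0 (fun h => f h + g h).
Proof.
move=> [C fC] [D gD]; exists (C + D); near=> h.
by apply: (le_trans (ler_rnormD _ _)); apply: lerD; near: h.
Unshelve. all: by end_near.
Qed.

Lemma locbdd0N V (f : R[i] -> V) : locbdd0 f -> locbdd0 (fun h => - f h).
Proof.
by move=> [C fC]; exists C; near=> h; rewrite rnormN; near: h.
Unshelve. all: by end_near.
Qed.

Lemma locbdd0Z V (f : R[i] -> V) : locbdd0 f -> locbdd0 (fun h => h *: f h).
Proof.
move=> [C fC]; exists C; near=> h; rewrite rnormZ -[C]mul1r.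
apply: ler_pM; rewrite ?rnorm_ge0 //; last by near: h.
by apply: ltW; near: h; apply: near0_rnorm_lt.
Unshelve. all: by end_near.
Qed.

Lemma locbdd0M (A : banachAlgType R[i]) (f g : R[i] -> A) :
  locbdd0 f -> locbdd0 g -> locbdd0 (fun h => f h * g h).
Proof.
move=> [C fC] [D gD]; exists (C * D); near=> h.
apply: (le_trans (ler_rnormM _ _)).
by apply: ler_pM; rewrite ?rnorm_ge0 //; near: h.
Unshelve. all: by end_near.
Qed.

End LocallyBounded.

(** * Second-order Taylor expansions at the origin *)

Section Jets.
Variable R : realType.
Implicit Type V : normedModType R[i].
Implicit Type A : banachAlgType R[i].

(** The expansion a + h b + h^2 c + O(h^3) in Horner form, so that products and sums can be treated
    one power of [h] at a time. The equation holds for every [h]; only the bound on [r] is local. *)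
Definition jet2 V (f : R[i] -> V) (a b c : V) : Prop :=
  exists2 r : R[i] -> V, locbdd0 r &
    forall h, f h = a + h *: (b + h *: (c + h *: r h)).

Definition has_jet2 V (f : R[i] -> V) : Prop := exists a b c, jet2 f a b c.

Lemma jet2_locbdd0 V (f : R[i] -> V) a b c : jet2 f a b c ->
  exists2 s, locbdd0 s & forall h, f h = a + h *: s h.
Proof.
move=> [r rb fE]; exists (fun h => b + h *: (c + h *: r h)) => //.
apply: locbdd0D (locbdd0_cst _) _; apply: locbdd0Z.
by apply: locbdd0D (locbdd0_cst _) _; apply: locbdd0Z.
Qed.

Lemma jet2_cst V (x : V) : jet2 (fun=> x) x 0 0.
Proof.
exists (fun=> 0); first exact: locbdd0_cst.
by move=> h; rewrite !(scaler0, addr0).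
Qed.

Lemma jet2_affine V (x y : V) : jet2 (fun h => x + h *: y) x y 0.
Proof.
exists (fun=> 0); first exact: locbdd0_cst.
by move=> h; rewrite !(scaler0, addr0).
Qed.

Lemma jet2D V (f g : R[i] -> V) a b c a' b' c' :
  jet2 f a b c -> jet2 g a' b' c' ->
  jet2 (fun h => f h + g h) (a + a') (b + b') (c + c').
Proof.
move=> [r rb fE] [s sb gE]; exists (fun h => r h + s h); first exact: locbdd0D.
by move=> h; rewrite fE gE; do 3 rewrite addrACA -scalerDr.
Qed.

Lemma mul_affine A (h : R[i]) (a a' b b' : A) :
  (a + h *: b) * (a' + h *: b') =
  a * a' + h *: (a * b' + b * a' + h *: (b * b')).
Proof.
by rewrite mulrDl !mulrDr -!scalerAl -!scalerAr !scalerDr !addrA.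
Qed.

Lemma mul_affine_cross A (h : R[i]) (a a' b b' c c' : A) :
  a * (b' + h *: c') + (b + h *: c) * a' =
  a * b' + b * a' + h *: (a * c' + c * a').
Proof. by rewrite mulrDl mulrDr -scalerAl -scalerAr addrACA -scalerDr. Qed.

(** The product is expanded by peeling off one factor [h] at a time; whatever is left after the
    third is the remainder, a combination of locally bounded functions. *)
Lemma jet2M A (f g : R[i] -> A) a b c a' b' c' :
  jet2 f a b c -> jet2 g a' b' c' ->
  jet2 (fun h => f h * g h) (a * a') (a * b' + b * a')
       (a * c' + c * a' + b * b').
Proof.
move=> [r rb fE] [s sb gE].
exists (fun h => a * s h + r h * a'
   + (b * (c' + h *: s h) + (c + h *: r h) * b')
   + h *: ((c + h *: r h) * (c' + h *: s h))).
  have B1 (u : A) v : locbdd0 v -> locbdd0 (fun h => u + h *: (v h : A)).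
    by move=> vb; apply: locbdd0D (locbdd0_cst _) (locbdd0Z vb).
  have B2 (u : A) (v : R[i] -> A) :
      locbdd0 v -> locbdd0 (fun h => u * (v h : A)).
    by apply: locbdd0M (locbdd0_cst _).
  have B3 (u : R[i] -> A) (v : A) :
      locbdd0 u -> locbdd0 (fun h => (u h : A) * v).
    by move=> ub; apply: locbdd0M ub (locbdd0_cst _).
  apply: locbdd0D; first apply: locbdd0D; first apply: locbdd0D.
  - exact: B2.
  - exact: B3.
  - by apply: locbdd0D; [apply/B2/B1|apply/B3/B1].
  - by apply: locbdd0Z; apply: locbdd0M; apply: B1.
move=> h; rewrite fE gE mul_affine; congr (_ + h *: _).
(* The tails stay folded, so that each [mul_affine] extracts a single power of [h]. *)
set X := c + _; set X' := c' + _.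
rewrite mul_affine (mul_affine_cross h a a' b b') -addrA -scalerDr.
rewrite {1}/X {1}/X' (mul_affine_cross h a a' c c') [_ + (b * b' + _)]addrACA.
by rewrite -scalerDr addrA.
Qed.

(** The identity g(h) = g(0) - g(h) (f(h) - f(0)) g(0) bounds |g(h)| by |g(0)| + |h| D |g(h)|. Once
    |h| D is at most 1/2, the last term is absorbed and |g(h)| is at most 2 |g(0)|. *)
Lemma locbdd0_inv A (f g : R[i] -> A) : has_jet2 f ->
  (forall h, f h * g h = 1) -> (forall h, g h * f h = 1) -> locbdd0 g.
Proof.
move=> [a [b [c /jet2_locbdd0 [s [C sC] fE]]]] fg gf.
have f0 : f 0 = a by rewrite fE scale0r addr0.
have gE h : g h = g 0 - h *: (g h * s h * g 0).
  have -> : h *: (g h * s h * g 0) = g h * (f h - f 0) * g 0.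
    by rewrite f0 fE addrAC subrr add0r -scalerAr -scalerAl.
  by rewrite mulrBr gf mulrBl mul1r -mulrA fg mulr1 opprB addrC subrK.
pose D := (`|C| + 1) * (rnorm (g 0) + 1).
have D0 : 0 < D by rewrite mulr_gt0 // ltr_wpDl // rnorm_ge0.
exists (2 * rnorm (g 0)); near=> h.
have hD : rnorm h * D <= 2^-1.
  rewrite -ler_pdivlMr //; apply: ltW; near: h; apply: near0_rnorm_lt.
  by rewrite divr_gt0.
have sh : rnorm (s h) <= C by near: h.
have : rnorm (g h) <= rnorm (g 0) + rnorm h * (rnorm (g h) * D).
  rewrite {1}gE; apply: (le_trans (ler_rnormD _ _)).
  rewrite lerD2l rnormN rnormZ ler_wpM2l ?rnorm_ge0 //.
  apply: (le_trans (ler_rnormM _ _)); rewrite /D mulrA.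
  apply: ler_pM; rewrite ?rnorm_ge0 ?lerDl //.
  apply: (le_trans (ler_rnormM _ _)); apply: ler_wpM2l; rewrite ?rnorm_ge0 //.
  by rewrite (le_trans sh) // (le_trans (ler_norm _)) // lerDl.
have := rnorm_ge0 (g h); nra.
Unshelve. all: by end_near.
Qed.

(** A quadratic [Q] inverts [f] up to O(h^3). Multiplying f Q = 1 + h^3 t by [g] on the left gives g
    = Q - h^3 g t, and g t is locally bounded by [locbdd0_inv]. *)
Lemma has_jet2_inv A (f g : R[i] -> A) : has_jet2 f ->
  (forall h, f h * g h = 1) -> (forall h, g h * f h = 1) -> has_jet2 g.
Proof.
move=> fj2 fg gf; have gb := locbdd0_inv fj2 fg gf.
case: fj2 => [a [b [c fj]]].
have fa : f 0 = a.
  by case: fj => r _ ->; rewrite scale0r addr0.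
have aG : a * g 0 = 1 by rewrite -fa.
(* [q1] and [q2] are chosen so that [f h * Q h = 1 + O(h^3)]. *)
pose q1 := - (g 0 * (b * g 0)).
pose q2 := - (g 0 * (c * g 0 + b * q1)).
pose Q h := g 0 + h *: (q1 + h *: q2).
have Qj : jet2 Q (g 0) q1 q2.
  exists (fun=> 0); first exact: locbdd0_cst.
  by move=> h; rewrite scaler0 addr0.
have [t tb fQ] := jet2M fj Qj.
exists (g 0), q1, q2, (fun h => - (g h * t h)).
  by apply/locbdd0N/locbdd0M.
move=> h.
have : g h * (f h * Q h) = Q h by rewrite mulrA gf mul1r.
rewrite fQ aG mulrN mulrA aG mul1r addNr add0r.
rewrite mulrN mulrA aG mul1r.
rewrite -[- _ + _ + _]addrA addNr add0r.
rewrite mulrDr mulr1 -!scalerAr => /(canRL (addrK _)) gQ; rewrite {1}gQ.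
by rewrite /Q !(scalerDr, scalerN) !addrA.
Qed.

(** For these j, w = i^j differs from 1 while w^4 = 1, so the geometric sum 1 + w + w^2 + w^3
    vanishes. *)
Lemma sum_i_exp (h : R[i]) (j : nat) : (0 < j < 4)%N ->
  \sum_(k < 4) ('i ^+ k * h) ^+ j = 0.
Proof.
move=> j4; under eq_bigr do rewrite exprMn exprAC.
rewrite -mulr_suml; apply/eqP; rewrite mulf_eq0; apply/orP; left.
have wN1 : ('i : R[i]) ^+ j - 1 != 0.
  rewrite subr_eq0.
  case: j j4 => [|[|[|[|j]]]] // _.
  - by rewrite expr1 eq_complex /= oner_eq0 andbF.
  - by rewrite sqr_i eq_sym -subr_eq0 opprK -(natrD _ 1 1) pnatr_eq0.
  - by rewrite exprS sqr_i mulrN1 eq_complex /= oppr_eq0 oner_eq0 andbF.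
rewrite -(mulrI_eq0 _ (mulfI wN1)) -subrX1 -exprM mulnC exprM.
by rewrite (exprM _ 2 2) sqr_i sqrrN !expr1n subrr.
Qed.

(** Averaging over the four points i^k h kills the terms of degree 1 and 2 by [sum_i_exp]; the
    remainders contribute at most C h^3 at each point. *)
Lemma jet2_mean V (f : R[i] -> V) : has_jet2 f ->
  exists C : R, exists2 d : R, 0 < d & forall h : R, 0 < h -> h < d ->
    rnorm (f 0) *+ 4 <= \sum_(k < 4) rnorm (f ('i ^+ k * h%:C)) + C * h ^+ 3.
Proof.
move=> [a [b [c [r [C /near0_rnormP [d d0 rC]] fE]]]].
exists (C *+ 4); exists d => // h h0 hd.
have f0 : f 0 = a by rewrite fE scale0r addr0.
pose k4 (k : 'I_4) : R[i] := 'i ^+ k * h%:C.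
have k4h k : rnorm (k4 k) = h.
  by rewrite rnormM rnormX rnorm_i expr1n mul1r rnorm_real gtr0_norm.
have -> : rnorm (f 0) *+ 4 =
    rnorm (\sum_(k < 4) (f (k4 k) - k4 k ^+ 3 *: r (k4 k))).
  have E k : f (k4 k) - k4 k ^+ 3 *: r (k4 k) =
      a + (k4 k ^+ 1 *: b + k4 k ^+ 2 *: c).
    by rewrite fE !scalerDr !scalerA !exprS expr0 !mulr1 !mulrA !addrA addrK.
  have Z j v : (0 < j < 4)%N -> \sum_(k < 4) k4 k ^+ j *: v = 0 :> V.
    by move=> j4; rewrite -scaler_suml sum_i_exp // scale0r.
  under eq_bigr do rewrite E.
  rewrite !big_split /= !Z // !addr0 sumr_const card_ord f0.
  rewrite -(scaler_nat 4 a) rnormZ.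
  by rewrite -(rmorph_nat (real_complex R)) rnorm_real normr_nat mulr_natl.
apply: (le_trans (ler_rnorm_sum _)).
have -> : C *+ 4 * h ^+ 3 = \sum_(k < 4) (C * h ^+ 3).
  by rewrite sumr_const card_ord mulrnAl.
rewrite -big_split /=; apply: ler_sum => k _.
apply: (le_trans (ler_rnormD _ _)); rewrite lerD2l rnormN rnormZ mulrC.
have -> : rnorm (k4 k ^+ 3) = h ^+ 3 by rewrite rnormX k4h.
by apply: ler_wpM2r; [rewrite exprn_ge0 // ltW|apply: rC; rewrite k4h].
Qed.

End Jets.

(** * Liouville's theorem for functions vanishing at infinity *)

Section Liouville.
Variables (R : realType) (V : normedModType R[i]) (f : R[i] -> V).
Hypothesis f_jet : forall z, has_jet2 (fun h => f (z + h)).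

(** Stated on [R * R] so that the extreme value theorem can be applied on a closed square. *)
Lemma has_jet2_continuous :
  continuous (fun p : R * R => rnorm (f (p.1 +i* p.2))).
Proof.
move=> p; pose z := p.1 +i* p.2.
have [a [b [c /jet2_locbdd0 [s [C /near0_rnormP [d d0 sC]] fE]]]] := f_jet z.
have fz : f z = a by rewrite -(addr0 z) fE scale0r addr0.
apply/cvgrPdist_le => e e0 /=.
(* Moving each coordinate by less than [m] gives |h| < 2m, which is at most d and makes |h| |s(h)|
   at most e. *)
pose m := Num.min (d / 2) (e / (2 * (`|C| + 1))).
have C0 : 0 < `|C| + 1 by rewrite ltr_wpDl.
have m0 : 0 < m by rewrite lt_min !divr_gt0 // mulr_gt0.
have /cvgrPdist_lt/(_ _ m0) fstp : (@fst R R) @ p --> p.1 by exact: cvg_fst.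
have /cvgrPdist_lt/(_ _ m0) sndp : (@snd R R) @ p --> p.2 by exact: cvg_snd.
near=> q.
have q1 : `|p.1 - q.1| < m by near: q.
have q2 : `|p.2 - q.2| < m by near: q.
pose h := (q.1 - p.1) +i* (q.2 - p.2).
have hm : rnorm h < m + m.
  have -> : h = (q.1 - p.1)%:C + 'i * (q.2 - p.2)%:C.
    by rewrite /h; simpc.
  apply: (le_lt_trans (ler_rnormD _ _)).
  rewrite rnormM rnorm_i mul1r !rnorm_real.
  by rewrite distrC [`|q.2 - _|]distrC ltrD.
have hd : rnorm h < d.
  apply: (lt_le_trans hm); rewrite -(mulr2n m) -mulr_natr.
  by rewrite -ler_pdivlMr // ge_min lexx.
have qE : q.1 +i* q.2 = z + h.
  rewrite /z /h; simpc.
  by rewrite !addrA ![_ + q.1]addrC ![_ + q.2]addrC !addrK.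
rewrite qE -/z fz fE.
have H : rnorm (h *: s h) <= e.
  rewrite rnormZ; apply: (@le_trans _ _ ((m + m) * (`|C| + 1))).
    apply: ler_pM; rewrite ?rnorm_ge0 // ?ltW //.
    by rewrite (le_lt_trans (sC _ hd)) // (le_lt_trans (ler_norm _)) // ltrDl.
  have : m <= e / (2 * (`|C| + 1)) by rewrite ge_min lexx orbT.
  by rewrite ler_pdivlMr ?mulr_gt0 //; lra.
rewrite ler_distl; apply/andP; split.
  by have := ler_rnormD a (h *: s h); lra.
have := ler_rnormD (a + h *: s h) (- (h *: s h)).
by rewrite addrK rnormN; lra.
Unshelve. all: by end_near.
Qed.

Lemma liouville : (forall e : R, 0 < e ->
    exists T, forall z, T <= rnorm z -> rnorm (f z) <= e) -> f 0 = 0.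
Proof.
move=> finfty; apply: rnorm_eq0; apply/eqP/negPn/negP => f0.
pose m := rnorm (f 0).
have m0 : 0 < m by rewrite lt_neqAle eq_sym f0 rnorm_ge0.
have [T0 T0P] := finfty (m / 2) (divr_gt0 m0 (ltr0n _ 2)).
pose T := Num.max T0 0.
have T_ge0 : 0 <= T by rewrite le_max lexx orbT.
have TP x y : T < `|x| \/ T < `|y| -> rnorm (f (x +i* y)) <= m / 2.
  move=> xy; apply: T0P; apply: (@le_trans _ _ T); first by rewrite le_max lexx.
  have -> : rnorm (x +i* y) = Num.sqrt (x ^+ 2 + y ^+ 2)
    by rewrite /rnorm normc_def.
  rewrite -(ger0_norm T_ge0) -sqrtr_sqr ler_wsqrtr //.
  case: xy => /ltW; rewrite -(ger0_norm T_ge0) -ler_sqr ?nnegrE //;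
    rewrite !real_normK ?num_real // => H.
    by rewrite (le_trans H) // lerDl sqr_ge0.
  by rewrite (le_trans H) // lerDr sqr_ge0.
(* The margin 1 keeps the four points around a maximum inside the square of half-side [S], as h <= 1
   below. *)
pose S := T + 1.
have S0 : 0 < S by rewrite ltr_wpDl.
(* On the square the quadratic term is then at most 2 e S^2 = m / 4. *)
pose e := m / (8 * S ^+ 2).
have e0 : 0 < e by rewrite divr_gt0 // mulr_gt0 // exprn_gt0.
pose W (p : R * R) := rnorm (f (p.1 +i* p.2)) + e * (p.1 ^+ 2 + p.2 ^+ 2).
have Wc : continuous W.
  move=> p; apply: cvgD; first exact: has_jet2_continuous.
  apply: cvgMr; apply: cvgD; rewrite /=.
    exact: (cvgM cvg_fst cvg_fst).
  exact: (cvgM cvg_snd cvg_snd).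
pose K : set (R * R) := `[- S, S] `*` `[- S, S].
have K0 : K (0, 0) by split; rewrite /= in_itv /= oppr_le0 ltW.
have Kcompact : compact K by apply: compact_setX; exact: segment_compact.
have [[x y]] := @compact_EVT_max _ _ W K (ex_intro _ _ K0) Kcompact
  (continuous_subspaceT Wc).
rewrite inE => -[/=]; rewrite !in_itv /= -!ler_norml => xS yS Wmax.
have {Wmax}Wmax x' y' : `|x'| <= S -> `|y'| <= S -> W (x', y') <= W (x, y).
  move=> x'S y'S; apply: Wmax; rewrite inE.
  by split; rewrite /= in_itv /= -ler_norml.
(* Beyond [T] in some coordinate, [W] is at most m/2 + m/4, less than its value m at the origin; the
   maximum is thus attained in the inner square. *)
have xyT : `|x| <= T /\ `|y| <= T.
  apply: contrapT => /not_andP xyT.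
  have := Wmax 0 0; rewrite normr0 => /(_ (ltW S0) (ltW S0)).
  rewrite /W /= expr0n /= addr0 mulr0 addr0 -/m.
  have : rnorm (f (x +i* y)) <= m / 2.
    by apply: TP; case: xyT => /negP; rewrite -ltNge; [left|right].
  have xS2 : x ^+ 2 <= S ^+ 2.
    by rewrite -real_normK ?num_real // ler_sqr ?nnegrE // ltW.
  have yS2 : y ^+ 2 <= S ^+ 2.
    by rewrite -real_normK ?num_real // ler_sqr ?nnegrE // ltW.
  have : e * (x ^+ 2 + y ^+ 2) <= m / 4.
    rewrite /e mulrAC ler_pdivrMr ?mulr_gt0 ?exprn_gt0 //.
    by nra.
  by lra.
case: xyT => xT yT.
have [C [d d0]] := jet2_mean (f_jet (x +i* y)).
rewrite addr0 => fC.
(* The bounds keep the points in the square, make [jet2_mean] applicable, and ensure C h < 4 e. *)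
pose h := Num.min (Num.min 1 (d / 2)) (e / (`|C| + 1)).
have C0 : 0 < `|C| + 1 by rewrite ltr_wpDl.
have h0 : 0 < h.
  by rewrite !lt_min ltr01 (divr_gt0 d0 (ltr0n _ 2)) (divr_gt0 e0 C0).
have h1 : h <= 1 by rewrite !ge_min lexx.
have hd : h < d.
  have : h <= d / 2 by rewrite !ge_min lexx !orbT.
  by lra.
have hC : C * h < 4 * e.
  have : h <= e / (`|C| + 1) by rewrite ge_min lexx !orbT.
  rewrite ler_pdivlMr //; have := ler_norm C; have := normr_ge0 C; nra.
have := fC _ h0 hd.
rewrite !big_ord_recl big_ord0 /= /bump /= ?add1n addr0.
have -> : x +i* y + 'i ^+ 0 * h%:C = (x + h) +i* y
  by rewrite expr0 mul1r; simpc.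
have -> : x +i* y + 'i ^+ 1 * h%:C = x +i* (y + h)
  by rewrite expr1; simpc.
have -> : x +i* y + 'i ^+ 2 * h%:C = (x - h) +i* y
  by rewrite sqr_i; simpc.
have -> : x +i* y + 'i ^+ 3 * h%:C = x +i* (y - h)
  by rewrite exprS sqr_i; simpc.
have xS' s : `|s| <= h -> `|x + s| <= S.
  by move=> sh; rewrite (le_trans (ler_normD _ _)) // lerD // (le_trans sh).
have yS' s : `|s| <= h -> `|y + s| <= S.
  by move=> sh; rewrite (le_trans (ler_normD _ _)) // lerD // (le_trans sh).
have hh : `|h| <= h by rewrite gtr0_norm.
have hN : `|- h| <= h by rewrite normrN.
have := Wmax _ _ (xS' _ hh) yS; have := Wmax _ _ (xS' _ hN) yS.
have := Wmax _ _ xS (yS' _ hh); have := Wmax _ _ xS (yS' _ hN).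
rewrite /W /= -mulr_natl => W1 W2 W3 W4 H.
(* The squared moduli of the four points sum to 4 |z|^2 + 4 h^2, while their [W] values sum to at
   most 4 W(z). Hence the gain 4 e h^2 is at most the error C h^3. *)
have : 4 * e * h ^+ 2 <= C * h * h ^+ 2.
  by rewrite -[C * h * _]mulrA -exprS; lra.
by rewrite ler_pM2r ?exprn_gt0 // leNgt hC.
Qed.

End Liouville.

(** * Expansion and growth of the monic polynomial *)

Section MonicPolynomial.
Variables (R : realType) (A : banachAlgType R[i]) (n : nat) (a : 'I_n -> A).

Let p (z : R[i]) : A := z ^+ n *: (1 : A) + \sum_(i < n) z ^+ i *: a i.

(** Induction on the exponent: each further factor z + h, seen as a scalar multiple of the unit,
    multiplies by an affine jet. *)
Lemma has_jet2_expZ (z : R[i]) (i : nat) (x : A) :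
  has_jet2 (fun h => (z + h) ^+ i *: x).
Proof.
elim: i => [|i [u [v [w fj]]]].
  by exists x, 0, 0; under eq_fun do rewrite expr0 scale1r; exact: jet2_cst.
have E h : (z + h) ^+ i.+1 *: x = (z *: 1 + h *: 1) * ((z + h) ^+ i *: x).
  by rewrite -scalerDl -scalerAl mul1r exprS scalerA.
under eq_fun do rewrite E.
do 3 eexists; exact: jet2M (jet2_affine _ _) fj.
Qed.

Lemma has_jet2_monic (z : R[i]) : has_jet2 (fun h => p (z + h)).
Proof.
have D (f g : R[i] -> A) : has_jet2 f -> has_jet2 g ->
    has_jet2 (fun h => f h + g h).
  by move=> [? [? [? fj]]] [? [? [? gj]]]; do 3 eexists; exact: jet2D fj gj.
apply: (D); first exact: has_jet2_expZ.
elim: (index_enum _) => [|i s IHs].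
  by exists 0, 0, 0; under eq_fun do rewrite big_nil; exact: jet2_cst.
under eq_fun do rewrite big_cons.
by apply: (D _ _ _ IHs); exact: has_jet2_expZ.
Qed.

(** From z^n g = 1 - (sum of z^i a_i) g and |z| >= 1 comes |z|^n |g| <= |1| + |z|^(n-1) S |g|, hence
    (|z| - S) |g| <= |1|. *)
Lemma monic_inv_infty (g : R[i] -> A) : (0 < n)%N ->
  (forall z, p z * g z = 1) -> forall e : R, 0 < e ->
  exists T, forall z, T <= rnorm z -> rnorm (g z) <= e.
Proof.
move=> n0 pg e e0.
pose S := \sum_(i < n) rnorm (a i).
have S0 : 0 <= S by apply: sumr_ge0 => i _; exact: rnorm_ge0.
have N0 : 0 <= rnorm (1 : A) / e by rewrite divr_ge0 ?rnorm_ge0 // ltW.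
(* The summand 1 gives |z| >= 1, and makes the final comparison strict: (1 + |1| / e) e = e + |1| >
   |1|. *)
exists (S + 1 + rnorm (1 : A) / e) => z zT.
set t := rnorm z in zT *; set G := rnorm (g z).
have t1 : 1 <= t by lra.
have tm : 1 <= t ^+ n.-1 by rewrite exprn_ege1.
have H : t ^+ n * G <= rnorm (1 : A) + t ^+ n.-1 * (S * G).
  have -> : t ^+ n * G = rnorm (1 - (\sum_(i < n) z ^+ i *: a i) * g z).
    by rewrite -(pg z) /p mulrDl addrK -scalerAl mul1r rnormZ rnormX.
  apply: (le_trans (ler_rnormD _ _)); rewrite lerD2l rnormN.
  apply: (le_trans (ler_rnormM _ _)); rewrite mulrA ler_wpM2r ?rnorm_ge0 //.
  apply: (le_trans (ler_rnorm_sum _)); rewrite mulr_sumr; apply: ler_sum => i _.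
  rewrite rnormZ rnormX ler_wpM2r ?rnorm_ge0 //.
  by rewrite ler_weXn2l // -ltnS prednK.
have G0 : 0 <= G by exact: rnorm_ge0.
move: H; rewrite -{1}(prednK n0) exprSr => H.
have H2 : (t - S) * G <= rnorm (1 : A).
  have [//|H3] := leP ((t - S) * G) (rnorm (1 : A)).
  have : rnorm (1 : A) <= t ^+ n.-1 * rnorm (1 : A)
    by rewrite ler_peMl // rnorm_ge0.
  have : t ^+ n.-1 * rnorm (1 : A) < t ^+ n.-1 * ((t - S) * G).
    by rewrite ltr_pM2l // (lt_le_trans ltr01).
  by lra.
rewrite leNgt; apply/negP => eG.
have H4 : (1 + rnorm (1 : A) / e) * G <= rnorm (1 : A).
  by apply: le_trans H2; apply: ler_wpM2r => //; lra.
have H5 : (1 + rnorm (1 : A) / e) * e < (1 + rnorm (1 : A) / e) * G.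
  by rewrite ltr_pM2l // ltr_wpDr.
have := lt_le_trans H5 H4.
by rewrite mulrDl mul1r divfK ?gt_eqF // gtrDr ltNge ltW.
Qed.

End MonicPolynomial.

Theorem mainTheorem1 (R : realType) (A : banachAlgType R[i])
    (n : nat) (hn : (1 <= n)%N) (a : 'I_n -> A) :
  exists z : R[i], ~ invertible (z ^+ n *: (1 : A) + \sum_(i < n) z ^+ i *: a i).
Proof.
apply/existsNP => /choice[g gP].
have pg z := (gP z).1; have gp z := (gP z).2.
have g_jet z : has_jet2 (fun h => g (z + h)).
  by apply: (has_jet2_inv (has_jet2_monic a z)).
have g0 := liouville g_jet (monic_inv_infty hn pg).
(* With g(0) = 0, p(0) g(0) = 1 reads 0 = 1. *)
by have := pg 0; rewrite g0 mulr0 => /eqP; rewrite eq_sym oner_eq0.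
Qed.
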